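(* Consider algorithm ALFCG-D (the deterministic case, defined in the context) applied to $\min_{x\in\mathcal X}F(x)=f(x)+h(x)$, where $f$ is $L$-smooth on $\mathcal X$. Let $\kappa=1+\rho D$, $L'=\rho+4L\kappa+4\rho^3D^2$, $\omega=\frac{L\kappa^2}{\rho^2}$, $\lambda=\frac{1}{8\omega\rho^2}$, $\overline F=2\big(F(x_0)-F_*+D^2\rho+\omega|\ln\rho|+\omega|\ln\lambda|+\omega\lambda L'\big)$, $\overline L=L'+4\rho^2\overline F$, and $C=\frac{\overline F\cdot\overline L}{\rho}$. Then for every integer $T\ge 0$ the average Frank-Wolfe gap satisfies $$\frac1{T+1}\sum_{t=0}^T\mathcal G(x_t)\le\frac{C}{\sqrt{T+1}} .$$ Consequently, for any $\epsilon>0$, the algorithm finds an $\epsilon$-approximate solution, i.e. $\min_{0\le t\le T}\mathcal G(x_t)\le\epsilon$, within at most $T=\lceil C^2\epsilon^{-2}-1\rceil$ iterations.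
   Context: Problem: $\mathcal X\subset\mathbb R^n$ is compact and convex with finite diameter $D=\sup_{x,y\in\mathcal X}\|x-y\|$ (Euclidean norm); $h:\mathbb R^n\to(-\infty,+\infty]$ is proper, closed and convex; $f$ is differentiable, possibly nonconvex, with $\|\nabla f(x)-\nabla f(y)\|\le L\|x-y\|$ for all $x,y\in\mathcal X$ ($L>0$); $F=f+h$; $\mathrm{dom}(F)\cap\mathcal X\ne\emptyset$, and $F_*=\inf_{x\in\mathcal X}F(x)$ is finite and attained. Frank-Wolfe gap: $\mathcal G(x)=\max_{v\in\mathcal X}\{\langle\nabla f(x),x-v\rangle+h(x)-h(v)\}$. Algorithm ALFCG-D: fix $\rho>0$, start at $x_0\in\mathcal X\cap\mathrm{dom}(h)$. For $t=0,1,2,\dots$: $g_t=\nabla f(x_t)$; $L_t=\rho\big(1+\sum_{i=0}^{t-1}L_i^2\|x_{i+1}-x_i\|^2\big)^{1/2}$ (so $L_0=\rho$); $v_t\in\arg\min_{v\in\mathcal X}\langle v,g_t\rangle+h(v)$; $x_{t+1}=x_t+\bar\eta_t(v_t-x_t)$ with $\bar\eta_t=\min\Big(\frac{h(x_t)-h(v_t)-\langle g_t,v_t-x_t\rangle}{L_t\|v_t-x_t\|^2},1\Big)$ (if $v_t=x_t$, then $x_{t+1}=x_t$). *)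

(* Defs.v *)
From HB Require Import structures.
From mathcomp Require Export all_boot all_order all_algebra.
From mathcomp Require Export all_classical all_reals all_analysis.

From mathcomp Require Import lra.

Set Implicit Arguments.
Unset Strict Implicit.
Unset Printing Implicit Defensive.

Export Order.TTheory GRing.Theory Num.Theory.
Export numFieldNormedType.Exports.

Local Open Scope classical_set_scope.
Local Open Scope ring_scope.

(* The library norm `|x| on 'rV[R]_n is the sup norm, hence the Euclidean norm
   below.  Both induce the same topology, so the library notions [compact],
   [closed] and [differentiable] are the usual ones on R^n. *)
Definition dot (R : realType) (n : nat) (u v : 'rV[R]_n) : R :=
  \sum_(i < n) u ord0 i * v ord0 i.

Definition enorm (R : realType) (n : nat) (u : 'rV[R]_n) : R :=
  Num.sqrt (dot u u).

Definition grad (R : realType) (n : nat) (f : 'rV[R]_n -> R) (x : 'rV[R]_n) :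
  'rV[R]_n := \row_(i < n) 'D_(delta_mx ord0 i) f x.

Local Open Scope ereal_scope.

(* Proper, closed (closed epigraph) and convex functions
   R^n -> (-oo, +oo], seen as \bar R-valued functions omitting -oo. *)
Definition proper_fun (R : realType) (n : nat) (h : 'rV[R]_n -> \bar R) : Prop :=
  (forall x, h x != -oo) /\ (exists x, h x < +oo).

Definition closed_fun (R : realType) (n : nat) (h : 'rV[R]_n -> \bar R) : Prop :=
  closed [set p : 'rV[R]_n * R | h p.1 <= p.2%:E].

(* In \bar R, 0 * +oo = 0: the inequality is trivial for k = 0 and k = 1. *)
Definition econvex_fun (R : realType) (n : nat) (h : 'rV[R]_n -> \bar R) : Prop :=
  forall (x y : 'rV[R]_n) (k : R), (0 <= k <= 1)%R ->
    h (k *: x + (1 - k) *: y)%R <= k%:E * h x + (1 - k)%:E * h y.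

Definition objective (R : realType) (n : nat) (f : 'rV[R]_n -> R)
  (h : 'rV[R]_n -> \bar R) (x : 'rV[R]_n) : \bar R := (f x)%:E + h x.

Definition is_argmin (T : Type) (R : realType) (X : set T) (phi : T -> \bar R)
  (v : T) : Prop := X v /\ forall u, X u -> phi v <= phi u.

(* The maximum is taken as a supremum in \bar R; it is attained at every
   solution of the linear minimisation subproblem, see [fw_gap_attained]. *)
Definition fw_gap (R : realType) (n : nat) (X : set 'rV[R]_n)
  (f : 'rV[R]_n -> R) (h : 'rV[R]_n -> \bar R) (x : 'rV[R]_n) : \bar R :=
  ereal_sup [set (dot (grad f x) (x - v)%R)%:E + h x - h v | v in X].

(* h x and h v are finite along a run of the algorithm, so that [fine] does not
   alter the value.  If v = x, division by 0 yields some real number, whose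
   value is irrelevant as it only multiplies v - x = 0. *)
Definition step_size (R : realType) (n : nat) (f : 'rV[R]_n -> R)
  (h : 'rV[R]_n -> \bar R) (Lt : R) (x v : 'rV[R]_n) : R :=
  Order.min ((fine (h x) - fine (h v) - dot (grad f x) (v - x))
             / (Lt * enorm (v - x) ^+ 2))%R 1%R.

(* (x, v, Ls) is a run of ALFCG-D with parameter rho: iterates x_t, subproblem
   solutions v_t (any selection from the argmin) and estimates L_t. *)
Record ALFCG_D_run (R : realType) (n : nat) (X : set 'rV[R]_n)
    (f : 'rV[R]_n -> R) (h : 'rV[R]_n -> \bar R) (rho : R)
    (x v : nat -> 'rV[R]_n) (Ls : nat -> R) : Prop := {
  run_init_X : X (x 0%N) ;
  run_init_dom : h (x 0%N) < +oo ;
  run_L : forall t : nat, Ls t =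
    (rho * Num.sqrt
       (1 + \sum_(i < t) Ls i ^+ 2 * enorm (x i.+1 - x i) ^+ 2))%R ;
  run_v : forall t : nat,
    is_argmin X (fun u => (dot u (grad f (x t)))%:E + h u) (v t) ;
  run_x : forall t : nat, x t.+1 =
    (x t + step_size f h (Ls t) (x t) (v t) *: (v t - x t))%R
}.

Lemma fw_gap_attained (R : realType) (n : nat) (X : set 'rV[R]_n)
    (f : 'rV[R]_n -> R) (h : 'rV[R]_n -> \bar R) (x v : 'rV[R]_n) :
  (forall y, h y != -oo) -> h x < +oo ->
  is_argmin X (fun u => (dot u (grad f x))%:E + h u) v ->
  fw_gap X f h x = (dot (grad f x) (x - v)%R)%:E + h x - h v.
Proof.
move=> hN hx [Xv vmin].
have dotC (a b : 'rV[R]_n) : dot a b = dot b a.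
  by apply: eq_bigr => i _; rewrite mulrC.
have dotB (a b c : 'rV[R]_n) : dot a (b - c)%R = (dot b a - dot c a)%R.
  rewrite /dot -sumrB; apply: eq_bigr => i _.
  by rewrite !mxE mulrBr ![(a _ _ * _)%R]mulrC.
apply/eqP; rewrite eq_le; apply/andP; split; last first.
  by apply: ereal_sup_ubound; exists v.
apply: ge_ereal_sup => _ [u Xu <-].
have := vmin u Xu; rewrite !dotB.
move: (hN x) (hN u) (hN v) hx.
case: (h x) => [a| |] //; case: (h u) => [b| |] //; case: (h v) => [c| |] //= _ _ _ _.
all: rewrite ?leNye // -?EFinD ?lee_fin //; lra.
Qed.

(* Main.v *)
Require Import Defs.
From mathcomp Require Import ring lra.

(* Write G_t for the gap, eta_t for the step, r_t = |x_{t+1} - x_t| and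
   S_T = sum_{t < T} eta_t G_t.  By L-smoothness S_T exceeds F(x_0) - F_* by at
   most (L/2) sum r_t^2.  Since L_{t+1}^2 = L_t^2 (1 + rho^2 r_t^2) and
   r_t <= D, each (L/2) r_t^2 is at most omega (ln L_{t+1} - ln L_t), so
   S_T <= F(x_0) - F_* + omega ln (L_T / rho).  Conversely the step rule gives
   L_t r_t^2 <= eta_t G_t, hence L_T <= rho + (rho^2 / 2) S_T.  Bounding ln L_T
   by its tangent lambda L_T - 1 - ln lambda, the two inequalities close up into
   S_T + D <= Fbar and L_T <= Lbar.  Finally G_t <= eta_t G_t + D L_t r_t,
   whether the step is clipped or not, and Cauchy-Schwarz bounds the sum of
   L_t r_t by sqrt(T + 1) L_{T+1} / rho. *)

Set Implicit Arguments.
Unset Strict Implicit.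
Unset Printing Implicit Defensive.

Local Open Scope classical_set_scope.
Local Open Scope ring_scope.

(** * Euclidean inner product and norm *)

Section Euclid.
Variables (R : realType) (n : nat).
Implicit Types (u v w : 'rV[R]_n) (a : R).

Lemma dotC u v : dot u v = dot v u.
Proof. by apply: eq_bigr => i _; rewrite mulrC. Qed.

Lemma dotBl u v w : dot (u - v) w = dot u w - dot v w.
Proof. by rewrite /dot -sumrB; apply: eq_bigr => i _; rewrite !mxE mulrBl. Qed.

Lemma dotZl a u v : dot (a *: u) v = a * dot u v.
Proof. by rewrite /dot mulr_sumr; apply: eq_bigr => i _; rewrite mxE mulrA. Qed.

Lemma dotBr u v w : dot u (v - w) = dot u v - dot u w.
Proof. by rewrite dotC dotBl !(dotC u). Qed.

Lemma dotZr a u v : dot u (a *: v) = a * dot u v.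
Proof. by rewrite dotC dotZl dotC. Qed.

Lemma dot_ge0 u : 0 <= dot u u.
Proof. by apply: sumr_ge0 => i _; rewrite -expr2 sqr_ge0. Qed.

Lemma enorm_ge0 u : 0 <= enorm u.
Proof. exact: sqrtr_ge0. Qed.

Lemma sqr_enorm u : enorm u ^+ 2 = dot u u.
Proof. exact/sqr_sqrtr/dot_ge0. Qed.

Lemma enormZ a u : enorm (a *: u) = `|a| * enorm u.
Proof.
by rewrite /enorm dotZl dotZr mulrA -expr2 sqrtrM ?sqr_ge0// sqrtr_sqr.
Qed.

Lemma enorm0_eq0 u : enorm u = 0 -> u = 0.
Proof.
move=> u0; have /psumr_eq0P : dot u u = 0 by rewrite -sqr_enorm u0 expr0n.
move=> uu0; apply/rowP => i; rewrite mxE; apply/eqP.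
by rewrite -sqrf_eq0 expr2 uu0// => j _; rewrite -expr2 sqr_ge0.
Qed.

(** For nonzero norms a and b, and c the inner product, the squared norm of
    [enorm v *: u - enorm u *: v] expands to 2ab(ab - c), and ab > 0 cancels. *)
Lemma cauchy_schwarz u v : dot u v <= enorm u * enorm v.
Proof.
have [u0|u_neq0] := eqVneq (enorm u) 0.
  by rewrite u0 mul0r (enorm0_eq0 u0) -(scale0r 0) dotZl mul0r.
have [v0|v_neq0] := eqVneq (enorm v) 0.
  by rewrite v0 mulr0 (enorm0_eq0 v0) -(scale0r 0) dotZr mul0r.
have uv_gt0 : 0 < enorm u * enorm v by rewrite mulr_gt0// lt0r enorm_ge0 andbT.
have := dot_ge0 (enorm v *: u - enorm u *: v).
rewrite dotBl !dotBr !dotZl !dotZr -!sqr_enorm (dotC v u).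
move: uv_gt0; set a := enorm u; set b := enorm v; set c := dot u v => ab H.
rewrite -(ler_pM2l ab); nra.
Qed.

End Euclid.

(** Cauchy-Schwarz against the all-ones vector. *)
Lemma sum_le_sqrt_sum_sqr (R : realType) (N : nat) (a : nat -> R) :
  \sum_(i < N) a i <= Num.sqrt N%:R * Num.sqrt (\sum_(i < N) a i ^+ 2).
Proof.
have := cauchy_schwarz (const_mx 1 : 'rV[R]_N) (\row_i a i).
rewrite /enorm /dot.
under eq_bigr do rewrite !mxE mul1r.
under [\sum_(i < N) const_mx _ _ _ * _]eq_bigr do rewrite !mxE mulr1.
under [\sum_(i < N) (\row_i a i) _ _ * _]eq_bigr do rewrite !mxE -expr2.
by rewrite sumr_const card_ord.
Qed.

(** This is ln z <= z - 1 at z = c y, that is, the tangent of [ln] at 1/c. The point stays free: [c]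
    is 1 in the one-step bound and [lambda] in the closing argument. *)
Lemma ln_le_linear (R : realType) (c y : R) : 0 < c -> 0 < y ->
  ln y <= c * y - 1 - ln c.
Proof.
move=> c0 y0; have cy0 : 0 < c * y by rewrite mulr_gt0.
have := @le_ln1Dx R (c * y - 1); rewrite (addrC 1) subrK lnM ?posrE//.
by move=> /(_ _); lra.
Qed.

(** * Adaptive estimates on abstract real sequences *)

Section AdaptiveEstimates.
Variables (R : realType) (D L rho Fs : R) (G eta r F Ls : nat -> R).
Hypotheses (D_ge0 : 0 <= D) (L_gt0 : 0 < L) (rho_gt0 : 0 < rho)
  (LsE : forall t, Ls t =
     rho * Num.sqrt (1 + \sum_(i < t) Ls i ^+ 2 * r i ^+ 2))
  (r_bound : forall t, 0 <= r t <= D)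
  (F_ge : forall t, Fs <= F t)
  (descent : forall t, F t.+1 <= F t - eta t * G t + L / 2 * r t ^+ 2)
  (step_le : forall t, Ls t * r t ^+ 2 <= eta t * G t)
  (gap_le : forall t, G t <= eta t * G t + D * (Ls t * r t)).

Let kappa := 1 + rho * D.
Let omega := L * kappa ^+ 2 / rho ^+ 2.
Let S T := \sum_(t < T) eta t * G t.

Lemma sqr_LsE t :
  Ls t ^+ 2 = rho ^+ 2 * (1 + \sum_(i < t) Ls i ^+ 2 * r i ^+ 2).
Proof.
rewrite LsE exprMn sqr_sqrtr// addr_ge0// sumr_ge0// => i _.
by rewrite mulr_ge0 ?sqr_ge0.
Qed.

Lemma Ls_gt0 t : 0 < Ls t.
Proof.
rewrite LsE mulr_gt0// sqrtr_gt0 ltr_pwDl// sumr_ge0// => i _.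
by rewrite mulr_ge0 ?sqr_ge0.
Qed.

(** The term added to the sum is itself proportional to L_t^2, so the recursion is multiplicative
    and logarithms telescope. *)
Lemma sqr_LsS t : Ls t.+1 ^+ 2 = Ls t ^+ 2 * (1 + (rho * r t) ^+ 2).
Proof. by rewrite sqr_LsE big_ord_recr/= addrA mulrDr -sqr_LsE; ring. Qed.

Lemma Ls0 : Ls 0%N = rho.
Proof. by rewrite LsE big_ord0 addr0 sqrtr1 mulr1. Qed.

Lemma Ls_leS t : Ls t <= Ls t.+1.
Proof.
rewrite -ler_sqr ?nnegrE ?(ltW (Ls_gt0 _))// sqr_LsS mulrDr mulr1.
by rewrite lerDl mulr_ge0 ?sqr_ge0.
Qed.

Lemma rho_le_Ls t : rho <= Ls t.
Proof. by elim: t => [|t IH]; [rewrite Ls0|exact: le_trans IH (Ls_leS t)]. Qed.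

Lemma omega_gt0 : 0 < omega.
Proof.
by rewrite divr_gt0 ?mulr_gt0 ?exprn_gt0// ltr_pwDl// mulr_ge0// ltW.
Qed.

(** With s = 1 + (rho r_t)^2, the log difference is (ln s) / 2, and ln s >= 1 - 1/s = (rho r_t)^2 /
    s. Since r_t <= D gives s <= kappa^2, the factor [omega] is exactly what remains. *)
Lemma sqr_step_le_ln t : L / 2 * r t ^+ 2 <= omega * (ln (Ls t.+1) - ln (Ls t)).
Proof.
have [r0 rD] := andP (r_bound t).
have k1 : 1 <= kappa by rewrite lerDl mulr_ge0// ltW.
set s := 1 + (rho * r t) ^+ 2.
have s1 : 1 <= s by rewrite lerDl sqr_ge0.
have s0 : 0 < s by apply: lt_le_trans s1.
have sk : s <= kappa ^+ 2.
  have rrD : rho * r t <= rho * D by rewrite ler_pM2l.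
  have rr0 : 0 <= rho * r t by rewrite mulr_ge0// ltW.
  by rewrite /s /kappa; nra.
have lnE : 2 * (ln (Ls t.+1) - ln (Ls t)) = ln s.
  have : ln (Ls t.+1 ^+ 2) = ln (Ls t ^+ 2 * s) by rewrite sqr_LsS.
  rewrite lnM ?posrE ?exprn_gt0 ?Ls_gt0// !lnXn ?Ls_gt0//; lra.
have lns : 1 - s^-1 <= ln s.
  have := @ln_le_linear R 1 s^-1; rewrite ln1 lnV ?posrE// invr_gt0.
  by move=> /(_ ltr01 s0); lra.
have : (rho * r t) ^+ 2 / kappa ^+ 2 <= ln s.
  apply: le_trans lns.
  have -> : 1 - s^-1 = (rho * r t) ^+ 2 / s.
    have -> : (rho * r t) ^+ 2 = s - 1 by rewrite /s; ring.
    by field; rewrite gt_eqF.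
  rewrite ler_wpM2l ?sqr_ge0// lef_pV2 ?posrE//.
  by rewrite exprn_gt0// (lt_le_trans _ k1).
move=> H.
have -> : L / 2 * r t ^+ 2 = omega / 2 * ((rho * r t) ^+ 2 / kappa ^+ 2).
  by rewrite /omega; field; rewrite !gt_eqF// (lt_le_trans _ k1).
have -> : omega * (ln (Ls t.+1) - ln (Ls t)) = omega / 2 * ln s.
  by rewrite -lnE; field.
by rewrite ler_wpM2l// divr_ge0// ltW// omega_gt0.
Qed.

Lemma progress_le_ln T : S T <= F 0%N - Fs + omega * (ln (Ls T) - ln rho).
Proof.
(* Keeping [F T] instead of its lower bound lets the induction telescope. *)
suff : S T <= F 0%N - F T + omega * (ln (Ls T) - ln rho).
  by have := F_ge T; lra.
elim: T => [|T IH]; first by rewrite /S big_ord0 Ls0 !subrr mulr0 addr0.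
rewrite /S big_ord_recr/= -/(S T).
by have := descent T; have := sqr_step_le_ln T; move: IH; lra.
Qed.

Lemma Ls_le_progress T : Ls T <= rho + rho ^+ 2 / 2 * S T.
Proof.
elim: T => [|T IH]; first by rewrite /S big_ord0 mulr0 addr0 Ls0.
rewrite /S big_ord_recr/= -/(S T) mulrDr.
have H : rho ^+ 2 / 2 * (Ls T * r T ^+ 2) <= rho ^+ 2 / 2 * (eta T * G T).
  by rewrite ler_wpM2l// divr_ge0// sqr_ge0.
suff : Ls T.+1 - Ls T <= rho ^+ 2 / 2 * (Ls T * r T ^+ 2) by lra.
(* From (L_{T+1} - L_T)^2 >= 0, 2 L_T (L_{T+1} - L_T) is at most L_{T+1}^2 - L_T^2 = (rho L_T
   r_T)^2. *)
rewrite -(ler_pM2l (Ls_gt0 T)).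
by have := sqr_ge0 (Ls T.+1 - Ls T); have := sqr_LsS T; lra.
Qed.

Let L' := rho + 4 * L * kappa + 4 * rho ^+ 3 * D ^+ 2.
Let lambda := 1 / (8 * omega * rho ^+ 2).
Let Fbar := 2 * (F 0%N - Fs + D ^+ 2 * rho
                   + omega * `|ln rho| + omega * `|ln lambda|
                   + omega * lambda * L').
Let Lbar := L' + 4 * rho ^+ 2 * Fbar.
Let C := Fbar * Lbar / rho.

Lemma lambda_gt0 : 0 < lambda.
Proof.
have om0 := omega_gt0.
by rewrite /lambda divr_gt0// mulr_gt0 ?exprn_gt0// mulr_gt0.
Qed.

Lemma rho_le_L' : rho <= L'.
Proof.
have r0 := ltW rho_gt0; have l0 := ltW L_gt0.
have k0 : 0 <= kappa by rewrite addr_ge0// mulr_ge0.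
rewrite /L' -addrA lerDl addr_ge0// mulr_ge0 ?exprn_ge0//.
  by rewrite mulr_ge0.
by rewrite mulr_ge0 ?exprn_ge0.
Qed.

(** [lambda] makes omega * lambda = 1 / (8 rho^2), so inserting the bound on S_T into the one on L_T
    returns only L_T / 16, which the left side absorbs. The extra [D] is included for the use made
    in [sum_gap_le]. *)
Lemma progress_and_Ls_le T : S T + D <= Fbar /\ Ls T <= Lbar.
Proof.
have om0 := omega_gt0.
have la0 := lambda_gt0.
have L'ge := rho_le_L'.
have olE : omega * lambda = (8 * rho ^+ 2)^-1.
  by rewrite /lambda; field; rewrite !gt_eqF.
have L'E : omega * lambda * L' =
    1 / 8 / rho + L * kappa / rho ^+ 2 / 2 + rho * D ^+ 2 / 2.
  by rewrite olE /L'; field; rewrite gt_eqF.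
have Lk0 : 0 <= L * kappa / rho ^+ 2 / 2.
  by rewrite !divr_ge0// ?mulr_ge0 ?addr_ge0 ?mulr_ge0 ?exprn_ge0// ltW.
set W := F 0%N - Fs + omega * `|ln rho| + omega * `|ln lambda|.
have FbarE : Fbar = 2 * (W + D ^+ 2 * rho + omega * lambda * L').
  by rewrite /Fbar /W; ring.
have W0 : 0 <= W.
  have := F_ge 0; have := mulr_ge0 (ltW om0) (normr_ge0 (ln rho)).
  by have := mulr_ge0 (ltW om0) (normr_ge0 (ln lambda)); rewrite /W; lra.
(* Minus logarithms are bounded by absolute values; the - omega coming from the tangent is
   dropped. *)
have S_le : S T <= W + (8 * rho ^+ 2)^-1 * Ls T.
  have := progress_le_ln T.
  have := ler_wpM2l (ltW om0) (ln_le_linear la0 (Ls_gt0 T)).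
  have := ler_wpM2l (ltW om0) (ler_norm (- ln rho)).
  have := ler_wpM2l (ltW om0) (ler_norm (- ln lambda)).
  by rewrite !normrN -olE /W; move: om0; lra.
(* Absorbing L_T / 16 leaves 15/16 of L_T on the left, whence the fifteenths. *)
have Ls_le : Ls T <= 16 / 15 * rho + 8 / 15 * (rho ^+ 2 * W).
  have := Ls_le_progress T.
  have : rho ^+ 2 * S T <= rho ^+ 2 * W + Ls T / 8.
    have -> : rho ^+ 2 * W + Ls T / 8 =
        rho ^+ 2 * (W + (8 * rho ^+ 2)^-1 * Ls T).
      by field; rewrite gt_eqF.
    by rewrite ler_wpM2l ?sqr_ge0.
  by lra.
have S_le' : S T <= 16 / 15 * W + 2 / 15 / rho.
  apply: le_trans S_le _.
  have -> : 16 / 15 * W + 2 / 15 / rho =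
      W + (8 * rho ^+ 2)^-1 * (16 / 15 * rho + 8 / 15 * (rho ^+ 2 * W)).
    by field; rewrite gt_eqF.
  by rewrite lerD2l ler_wpM2l// invr_ge0 mulr_ge0 ?sqr_ge0.
(* By AM-GM, D fits in what the bound on S T leaves of Fbar. *)
have D_le : D <= 3 * (rho * D ^+ 2) + 7 / 60 / rho.
  rewrite -(ler_pM2l rho_gt0).
  have -> : rho * (3 * (rho * D ^+ 2) + 7 / 60 / rho) =
      3 * (rho * D) ^+ 2 + 7 / 60.
    by field; rewrite gt_eqF.
  (* The square gives rho D <= 3 (rho D)^2 + 1/12, and 1/12 < 7/60. *)
  by have := sqr_ge0 (rho * D - 1 / 6); lra.
have rhoDD : 0 <= rho * D ^+ 2 by rewrite mulr_ge0 ?sqr_ge0// ltW.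
split.
  (* Fbar is at least 2 W + 3 rho D^2 + 1 / (4 rho), and 2/15 + 7/60 = 1/4. *)
  by rewrite FbarE L'E; move: S_le' D_le Lk0 W0; lra.
apply: le_trans Ls_le _; rewrite /Lbar.
have : 4 * rho ^+ 2 * (2 * W + 1 / 4 / rho) <= 4 * rho ^+ 2 * Fbar.
  apply: ler_wpM2l; first by rewrite pmulr_rge0 ?sqr_ge0.
  by rewrite FbarE L'E; lra.
have -> : 4 * rho ^+ 2 * (2 * W + 1 / 4 / rho) = 8 * (rho ^+ 2 * W) + rho.
  by field; rewrite gt_eqF.
have : 0 <= rho ^+ 2 * W by rewrite mulr_ge0 ?sqr_ge0.
by move: L'ge rho_gt0; lra.
Qed.

(** In [Fbar] every summand is nonnegative and the one with L' is positive. Strictness will make the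
    iteration count a natural number. *)
Lemma rate_gt0 : 0 < C.
Proof.
have [_ /(lt_le_trans (Ls_gt0 0))] := progress_and_Ls_le 0.
suff Fbar_gt0 : 0 < Fbar by move=> Lb; rewrite divr_gt0// mulr_gt0.
have om0 := omega_gt0.
have la0 := lambda_gt0.
have L'0 : 0 < L' := lt_le_trans rho_gt0 rho_le_L'.
have := F_ge 0; have := mulr_ge0 (ltW om0) (normr_ge0 (ln rho)).
have := mulr_ge0 (ltW om0) (normr_ge0 (ln lambda)).
have := mulr_gt0 (mulr_gt0 om0 la0) L'0.
have : 0 <= D ^+ 2 * rho by rewrite mulr_ge0 ?sqr_ge0// ltW.
by rewrite /Fbar; lra.
Qed.

Lemma sum_gap_le T : \sum_(t < T.+1) G t <= C * Num.sqrt T.+1%:R.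
Proof.
(* The sum over t <= T is the one that enters L_{T+1}, hence the shift. *)
have [SD _] := progress_and_Ls_le T.+1; have [_ LL] := progress_and_Ls_le T.+1.
have sT : 1 <= Num.sqrt T.+1%:R :> R
  by rewrite -[leLHS]sqrtr1 ler_wsqrtr// ler1n.
have rL : rho <= Lbar := le_trans (rho_le_Ls _) LL.
have Lr : 1 <= Lbar / rho by rewrite ler_pdivlMr// mul1r.
have Lr0 : 0 <= Lbar / rho by apply: le_trans Lr.
have S0 : 0 <= S T.+1.
  apply: sumr_ge0 => t _; apply: le_trans (step_le t).
  by rewrite mulr_ge0 ?sqr_ge0// ltW// Ls_gt0.
(* By [sqr_LsE], (L_{T+1} / rho)^2 is 1 plus this sum. *)
have root_le : Num.sqrt (\sum_(t < T.+1) (Ls t * r t) ^+ 2) <= Lbar / rho.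
  apply: (@le_trans _ _ (Ls T.+1 / rho)); last by rewrite ler_pM2r ?invr_gt0.
  rewrite -[leRHS]ger0_norm ?divr_ge0 ?(ltW (Ls_gt0 _)) ?(ltW rho_gt0)//.
  rewrite -sqrtr_sqr ler_wsqrtr// expr_div_n sqr_LsE mulrC mulKf; last first.
    by rewrite expf_neq0 ?gt_eqF.
  under eq_bigr do rewrite exprMn.
  by rewrite lerDr.
apply: (@le_trans _ _ (S T.+1 + D * \sum_(t < T.+1) Ls t * r t)).
  by rewrite mulr_sumr -big_split/=; apply: ler_sum => t _.
have sum_le : \sum_(t < T.+1) Ls t * r t <= Num.sqrt T.+1%:R * (Lbar / rho).
  apply: le_trans (@sum_le_sqrt_sum_sqr R T.+1 (fun t => Ls t * r t)) _.
  by rewrite ler_wpM2l ?sqrtr_ge0.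
(* As this factor is at least 1, it may multiply S_{T+1} too, so that only S_{T+1} + D has to be
   bounded. *)
have rate1 : 1 <= Num.sqrt T.+1%:R * (Lbar / rho) by apply: mulr_ege1.
apply: (@le_trans _ _ ((S T.+1 + D) * (Num.sqrt T.+1%:R * (Lbar / rho)))).
  by rewrite mulrDl lerD// ?ler_wpM2l// ler_peMr.
have -> : C * Num.sqrt T.+1%:R = Fbar * (Num.sqrt T.+1%:R * (Lbar / rho)).
  by rewrite /C; ring.
by rewrite ler_wpM2r// (le_trans ler01).
Qed.

End AdaptiveEstimates.

(** * Smoothness along segments *)

Lemma dot_gradE (R : realType) (n : nat) (f : 'rV[R]_n -> R) (y d : 'rV[R]_n) :
  differentiable f y -> 'D_d f y = dot (grad f y) d.
Proof.
move=> df; rewrite deriveE// [in LHS](row_sum_delta d) linear_sum/=.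
by apply: eq_bigr => i _; rewrite linearZ/= mxE deriveE// mulrC.
Qed.

(** The difference quotient along the line is that of [f] at [y + s *: d] in direction [d], so
    derivability and value both transfer. *)
Lemma is_derive_line (R : realType) (n : nat) (f : 'rV[R]_n -> R)
    (y d : 'rV[R]_n) (s : R) :
  differentiable f (y + s *: d) ->
  is_derive s 1 (fun s => f (y + s *: d)) (dot (grad f (y + s *: d)) d).
Proof.
move=> df.
have E : (fun e : R => e^-1 *:
      ((fun s => f (y + s *: d)) (e *: 1 + s) - f (y + s *: d)))
  = (fun e : R => e^-1 *: (f (e *: d + (y + s *: d)) - f (y + s *: d))).
  by apply/funext => e; rewrite /= scalerDl scaler1 addrCA.
split; last by rewrite -dot_gradE// /derive E.
by rewrite /derivable E; exact: diff_derivable.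
Qed.


Lemma convex_set_segment (R : realType) (n : nat) (X : set 'rV[R]_n)
    (y z : 'rV[R]_n) (s : R) :
  convex_set X -> X y -> X z -> 0 <= s <= 1 -> X (y + s *: (z - y)).
Proof.
move=> cX Xy Xz /andP[s0 s1].
have := cX z y (Itv01 s0 s1); rewrite !inE => /(_ Xz Xy).
suff -> : conv (Itv01 s0 s1) (z : convex_lmodType _) y = y + s *: (z - y) by [].
rewrite /conv/= /unstable.onem scalerBl scale1r scalerBr.
exact: addrCA.
Qed.

(** The mean value theorem replaces integration: [phi] is [f] on the segment minus the quadratic
    model's increment. Its derivative at s is the inner product of a gradient difference with d,
    minus L s |d|^2, hence nonpositive by Cauchy-Schwarz and the Lipschitz bound. Convexity keeps
    the segment in [X], where that bound holds. *)
Lemma descent_lemma (R : realType) (n : nat) (X : set 'rV[R]_n)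
    (f : 'rV[R]_n -> R) (L : R) (y z : 'rV[R]_n) :
  convex_set X -> (forall w, differentiable f w) ->
  (forall w w', X w -> X w' ->
     enorm (grad f w - grad f w') <= L * enorm (w - w')) ->
  X y -> X z ->
  f z <= f y + dot (grad f y) (z - y) + L / 2 * enorm (z - y) ^+ 2.
Proof.
move=> cX df Lip Xy Xz; set d := z - y.
pose K := L / 2 * enorm d ^+ 2; pose c := dot (grad f y) d.
pose phi (s : R) := f (y + s *: d) - (s * c + s ^+ 2 * K).
pose dphi (s : R) := dot (grad f (y + s *: d)) d - (c + 2 * s * K).
have phi_der (s : R) : is_derive s 1 phi (dphi s).
  have H1 := is_derive_line (df (y + s *: d)).
  have H2 : is_derive s 1 (fun s : R => c *: s + K *: s ^+ 2) (c + 2 * s * K).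
    apply: is_derive_eq; rewrite /GRing.scale/=; ring.
  rewrite /phi; under eq_fun do rewrite [_ * c]mulrC [_ * K]mulrC.
  exact: is_deriveB.
have phi_cont : {within `[0, 1], continuous phi}.
  apply: continuous_subspaceT => s.
  by apply/differentiable_continuous/derivable1_diffP; case: (phi_der s).
have [s s01] := MVT ltr01 (fun s _ => phi_der s) phi_cont.
rewrite subr0 mulr1 /phi scale1r scale0r addr0 /d subrKC -/d !mul1r.
suff : dphi s <= 0.
  by rewrite expr0n/= !mul0r expr1n !mul1r addr0 subr0 -/c -/K; lra.
move: s01; rewrite in_itv/= => /andP[s0 s1].
have Xs : X (y + s *: d).
  by apply: convex_set_segment => //; rewrite !ltW.
have : dot (grad f (y + s *: d) - grad f y) d <= L * s * enorm d * enorm d.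
  apply: le_trans (cauchy_schwarz _ _) _.
  rewrite ler_wpM2r ?enorm_ge0//; apply: le_trans (Lip _ _ Xs Xy) _.
  by rewrite addrAC subrr add0r enormZ gtr0_norm// mulrA.
rewrite dotBl /dphi -/c /K; lra.
Qed.

(** The minimum gives eta l d^2 <= G, and multiplying by eta yields the second claim. For the third,
    a clipped step has eta = 1, while an unclipped one has G = eta l d^2 <= D l eta d. The
    implication on d = 0 covers v_t = x_t, where the quotient carries no information. *)
Lemma clipped_step (R : realType) (l G d D : R) :
  0 < l -> 0 <= G -> 0 <= d <= D -> (d = 0 -> G = 0) ->
  let eta := Order.min (G / (l * d ^+ 2)) 1 in
  [/\ 0 <= eta <= 1, l * (eta * d) ^+ 2 <= eta * G
    & G <= eta * G + D * (l * (eta * d))].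
Proof.
move=> l0 G0 /andP[d0 dD] dG eta.
have eta01 : 0 <= eta <= 1.
  rewrite /eta ge_min lexx orbT le_min ler01 andbT divr_ge0//.
  by rewrite mulr_ge0 ?sqr_ge0// ltW.
split=> //.
  have [d_eq0|d_neq0] := eqVneq d 0; first by rewrite (dG d_eq0) d_eq0; lra.
  have ld0 : 0 < l * d ^+ 2 by rewrite mulr_gt0// exprn_even_gt0.
  have : eta * (l * d ^+ 2) <= G by rewrite -ler_pdivlMr// ge_min lexx.
  by case/andP: eta01 => e0 _ /(ler_wpM2l e0); rewrite exprMn; lra.
have [d_eq0|d_neq0] := eqVneq d 0; first by rewrite (dG d_eq0) d_eq0; lra.
have ld0 : 0 < l * d ^+ 2 by rewrite mulr_gt0// exprn_even_gt0.
have lr0 : 0 <= l * (eta * d) by case/andP: eta01 => *; rewrite !mulr_ge0// ltW.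
have [e1|e1] := leP (G / (l * d ^+ 2)) 1; last first.
  have eta1 : eta = 1 by apply/min_idPr/ltW.
  by rewrite {1}eta1 mul1r lerDl mulr_ge0// (le_trans d0).
have eG : eta * G >= 0 by case/andP: eta01 => *; rewrite mulr_ge0.
have eE : eta * (l * d ^+ 2) = G by rewrite /eta (min_idPl e1) divfK ?gt_eqF.
have := ler_wpM2r lr0 dD; lra.
Qed.

(** If every term exceeded eps, then (T + 1) eps < c sqrt(T + 1), so T + 1 < c^2 / eps^2, against
    the choice of T. *)
Lemma min_le_average (R : realType) (g : nat -> R) (c eps : R) (T : nat) :
  0 < c -> 0 < eps -> \sum_(t < T.+1) g t <= c * Num.sqrt T.+1%:R ->
  c ^+ 2 * eps ^- 2 - 1 <= T%:R -> exists t : 'I_T.+1, g t <= eps.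
Proof.
move=> c0 eps0 sum_le T_ge; apply: contrapT => /forallNP gt_eps.
have : T.+1%:R * eps < c * Num.sqrt T.+1%:R.
  apply: lt_le_trans sum_le.
  rewrite mulr_natl -[T.+1 in X in X < _]card_ord -sumr_const.
  apply: ltr_sum; first by apply/hasP; exists ord0; rewrite ?mem_index_enum.
  by move=> t _; rewrite ltNge; apply/negP/gt_eps.
have sT : 0 < Num.sqrt T.+1%:R :> R by rewrite sqrtr_gt0 ltr0n.
have sTE : Num.sqrt T.+1%:R ^+ 2 = T.+1%:R :> R by rewrite sqr_sqrtr.
rewrite -{1}sTE expr2 -mulrA mulrC ltr_pM2r// => lt_c.
have : (Num.sqrt T.+1%:R * eps) ^+ 2 < c ^+ 2.
  by rewrite ltr_sqr ?nnegrE ?mulr_ge0 ?ltW.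
rewrite exprMn sTE -ltr_pdivlMr ?exprn_gt0// -natr1.
by move: T_ge; lra.
Qed.

(** * One-step inequalities for runs of the algorithm *)

Section Run.
Variables (R : realType) (n : nat) (X : set 'rV[R]_n).
Variables (f : 'rV[R]_n -> R) (h : 'rV[R]_n -> \bar R) (D L rho : R).
Variables (x v : nat -> 'rV[R]_n) (Ls : nat -> R).
Hypotheses (X_convex : convex_set X)
  (X_diam : forall y z, X y -> X z -> enorm (y - z) <= D)
  (h_Ny : forall y, h y != -oo%E)
  (h_convex : econvex_fun h)
  (f_diff : forall y, differentiable f y)
  (f_smooth : forall y z, X y -> X z ->
     enorm (grad f y - grad f z) <= L * enorm (y - z))
  (rho_gt0 : 0 < rho)
  (run : ALFCG_D_run X f h rho x v Ls).

(** The numerator of the step size, real-valued; [run_fw_gap] identifies it with the gap. *)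
Let G t := fine (h (x t)) - fine (h (v t)) - dot (grad f (x t)) (v t - x t).
Let eta t := step_size f h (Ls t) (x t) (v t).
Let r t := enorm (x t.+1 - x t).

(** Test the minimality of [w] against [y]: the finite value at [y] forces [h w] to be finite, and
    rearranging gives the sign. *)
Lemma subproblem_bound (y w : 'rV[R]_n) :
  is_argmin X (fun u => (dot u (grad f y))%:E + h u)%E w ->
  X y -> (h y < +oo)%E ->
  [/\ X w, (h w < +oo)%E
    & 0 <= fine (h y) - fine (h w) - dot (grad f y) (w - y)].
Proof.
move=> [Xw /(_ y)] + Xy hy => /(_ Xy).
rewrite dotBr !(dotC (grad f y)); move: (h_Ny y) (h_Ny w) hy.
case: (h y) => [a| |] //; case: (h w) => [b| |] //= _ _ _.
by rewrite -!EFinD lee_fin ltry => H; split => //; lra.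
Qed.

Lemma run_Ls_gt0 t : 0 < Ls t.
Proof. exact: (Ls_gt0 rho_gt0 (run_L run)). Qed.

(** Feasibility is assumed at [t] only, because the induction proving it at all times needs the step
    to lie in [0, 1]. *)
Lemma run_step_facts t : X (x t) -> (h (x t) < +oo)%E ->
  [/\ 0 <= eta t <= 1, Ls t * r t ^+ 2 <= eta t * G t
    & G t <= eta t * G t + D * (Ls t * r t)].
Proof.
move=> Xx hx; have [Xv hv G0] := subproblem_bound (run_v run t) Xx hx.
have d0D : 0 <= enorm (v t - x t) <= D by rewrite enorm_ge0 X_diam.
have dG : enorm (v t - x t) = 0 -> G t = 0.
  move=> /enorm0_eq0 vx; rewrite /G vx.
  have -> : v t = x t by apply/eqP; rewrite -subr_eq0 vx.
  by rewrite -(scale0r 0) dotZr; lra.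
have [e01 H1 H2] := clipped_step (run_Ls_gt0 t) G0 d0D dG.
have rE : r t = eta t * enorm (v t - x t).
  rewrite /r (run_x run) addrAC subrr add0r enormZ ger0_norm//.
  by case/andP: e01.
by rewrite rE.
Qed.

Lemma run_feasible t : X (x t) /\ (h (x t) < +oo)%E.
Proof.
elim: t => [|t [Xx hx]].
  by split; [exact: run_init_X run|exact: run_init_dom run].
have [Xv hv _] := subproblem_bound (run_v run t) Xx hx.
have [e01 _ _] := run_step_facts Xx hx.
rewrite (run_x run); split; first exact: convex_set_segment.
have -> : x t + eta t *: (v t - x t) = eta t *: v t + (1 - eta t) *: x t.
  by rewrite scalerBl scale1r scalerBr addrCA.
apply: le_lt_trans (h_convex _ _ e01) _.
move: (h_Ny (x t)) (h_Ny (v t)) hx hv.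
case: (h (x t)) => [a| |] //; case: (h (v t)) => [b| |] // _ _ _ _.
by rewrite -!EFinM -EFinD ltry.
Qed.

(** Convexity of [h] along the step and the descent lemma for [f] add up: the first-order parts
    combine into - eta_t G_t. *)
Lemma run_descent t :
  f (x t.+1) + fine (h (x t.+1)) <=
  f (x t) + fine (h (x t)) - eta t * G t + L / 2 * r t ^+ 2.
Proof.
have [Xx hx] := run_feasible t; have [Xx' hx'] := run_feasible t.+1.
have [Xv hv _] := subproblem_bound (run_v run t) Xx hx.
have [e01 _ _] := run_step_facts Xx hx.
have := descent_lemma X_convex f_diff f_smooth Xx Xx'.
have xE : x t.+1 = eta t *: v t + (1 - eta t) *: x t.
  by rewrite (run_x run) scalerBl scale1r scalerBr addrCA.
have : fine (h (x t.+1)) <=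
    eta t * fine (h (v t)) + (1 - eta t) * fine (h (x t)).
  have := h_convex (v t) (x t) e01; rewrite -xE.
  move: (h_Ny (x t)) (h_Ny (v t)) (h_Ny (x t.+1)) hx hv hx'.
  case: (h (x t)) => [a| |] //; case: (h (v t)) => [b| |] //.
  by case: (h (x t.+1)) => [c| |] //; rewrite -!EFinM -EFinD lee_fin.
have -> : dot (grad f (x t)) (x t.+1 - x t) =
    eta t * dot (grad f (x t)) (v t - x t).
  by rewrite (run_x run) addrAC subrr add0r dotZr.
by rewrite /G -/(r t); lra.
Qed.

Lemma run_fw_gap t : fw_gap X f h (x t) = (G t)%:E.
Proof.
have [Xx hx] := run_feasible t.
have [Xv hv _] := subproblem_bound (run_v run t) Xx hx.
rewrite (fw_gap_attained h_Ny hx (run_v run t)) /G dotBr [in RHS]dotBr.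
move: (h_Ny (x t)) (h_Ny (v t)) hx hv.
case: (h (x t)) => [a| |] //; case: (h (v t)) => [b| |] //= _ _ _ _.
by congr EFin; lra.
Qed.

End Run.

(** * The convergence rate and the iteration count *)

Unset Implicit Arguments.

Theorem theorem9 (R : realType) (n : nat) (X : set 'rV[R]_n)
    (f : 'rV[R]_n -> R) (h : 'rV[R]_n -> \bar R)
    (D L rho Fs : R) (x v : nat -> 'rV[R]_n) (Ls : nat -> R)
    (X_compact : compact X)
    (X_convex : convex_set X)
    (X_diam : ereal_sup [set (enorm (p.1 - p.2))%:E | p in X `*` X] = D%:E)
    (h_proper : proper_fun h)
    (h_closed : closed_fun h)
    (h_convex : econvex_fun h)
    (f_diff : forall y, differentiable f y)
    (L_gt0 : 0 < L)
    (f_smooth : forall y z, X y -> X z ->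
       enorm (grad f y - grad f z) <= L * enorm (y - z))
    (dom_meets_X : exists2 y, X y & (objective f h y < +oo)%E)
    (Fs_inf : ereal_inf [set objective f h y | y in X] = Fs%:E)
    (Fs_attained : exists2 y, X y & objective f h y = Fs%:E)
    (rho_gt0 : 0 < rho)
    (run : ALFCG_D_run X f h rho x v Ls) :
  let kappa := 1 + rho * D in
  let L' := rho + 4 * L * kappa + 4 * rho ^+ 3 * D ^+ 2 in
  let omega := L * kappa ^+ 2 / rho ^+ 2 in
  let lambda := 1 / (8 * omega * rho ^+ 2) in
  let Fbar := 2 * (fine (objective f h (x 0%N)) - Fs + D ^+ 2 * rho
                   + omega * `|ln rho| + omega * `|ln lambda|
                   + omega * lambda * L') in
  let Lbar := L' + 4 * rho ^+ 2 * Fbar in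
  let C := Fbar * Lbar / rho in
  (forall T : nat,
     (((T.+1%:R)^-1)%:E * \sum_(t < T.+1) fw_gap X f h (x t)
       <= (C / Num.sqrt T.+1%:R)%:E)%E)
  /\
  (forall eps : R, 0 < eps ->
     exists2 T : nat, T%:Z = Num.ceil (C ^+ 2 * eps ^- 2 - 1)
       & (\big[Order.min/+oo]_(t < T.+1) fw_gap X f h (x t) <= eps%:E)%E).
Proof.
move=> kappa L' omega lambda Fbar Lbar C.
have diam y z : X y -> X z -> enorm (y - z) <= D.
  move=> Xy Xz; rewrite -lee_fin -X_diam.
  by apply: ereal_sup_ubound; exists (y, z).
have hN := h_proper.1.
have feas := run_feasible X_convex diam hN h_convex rho_gt0 run.
have D0 : 0 <= D.
  by apply: le_trans (diam _ _ (feas 0).1 (feas 0).1); exact: enorm_ge0.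
have r0D t : 0 <= enorm (x t.+1 - x t) <= D.
  by rewrite enorm_ge0 (diam _ _ (feas t.+1).1 (feas t).1).
have objE t : objective f h (x t) = (f (x t) + fine (h (x t)))%:E.
  by rewrite /objective EFinD fineK// fin_numE hN lt_eqF// (feas t).2.
have F_ge t : Fs <= f (x t) + fine (h (x t)).
  rewrite -lee_fin -objE -Fs_inf; apply: ereal_inf_lbound.
  by exists (x t) => //; exact: (feas t).1.
have gapE := run_fw_gap X_convex diam hN h_convex rho_gt0 run.
have desc := run_descent X_convex diam hN h_convex f_diff f_smooth rho_gt0 run.
have facts t := run_step_facts diam hN rho_gt0 run (feas t).1 (feas t).2.
pose G t := fine (h (x t)) - fine (h (v t)) - dot (grad f (x t)) (v t - x t).
pose eta t := step_size f h (Ls t) (x t) (v t).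
pose F t := f (x t) + fine (h (x t)).
pose r t := enorm (x t.+1 - x t).
have step_le t : Ls t * r t ^+ 2 <= eta t * G t by have [] := facts t.
have gap_le t : G t <= eta t * G t + D * (Ls t * r t) by have [] := facts t.
have CE : C = 2 * (F 0%N - Fs + D ^+ 2 * rho + omega * `|ln rho|
    + omega * `|ln lambda| + omega * lambda * L') * Lbar / rho.
  by rewrite /C /Fbar objE.
have C0 : 0 < C.
  rewrite CE /Lbar /Fbar objE.
  exact: (rate_gt0 D0 L_gt0 rho_gt0 (run_L run) r0D F_ge desc step_le).
have sum_le T : \sum_(t < T.+1) G t <= C * Num.sqrt T.+1%:R.
  rewrite CE /Lbar /Fbar objE.
  exact: (sum_gap_le D0 L_gt0 rho_gt0 (run_L run) r0D F_ge desc step_le gap_le).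
split=> [T|eps eps0].
  under eq_bigr do rewrite gapE.
  rewrite sumEFin -EFinM lee_fin mulrC ler_pdivrMr ?ltr0n//.
  apply: le_trans (sum_le T) _.
  have sT : 0 < Num.sqrt T.+1%:R :> R by rewrite sqrtr_gt0 ltr0n.
  (* Writing T + 1 as the square of its root cancels one factor. *)
  by rewrite -[X in _ <= _ * X](@sqr_sqrtr R T.+1%:R)// expr2 mulrA divfK//.
pose m := Num.ceil (C ^+ 2 * eps ^- 2 - 1).
(* A ceiling is nonnegative as soon as its argument exceeds -1, which C > 0 ensures. *)
have m0 : 0 <= m.
  by rewrite ceil_ge0 ltrBrDr addNr mulr_gt0 ?invr_gt0 ?exprn_gt0.
exists `|m|%N; first by rewrite gez0_abs.
have le_m : C ^+ 2 * eps ^- 2 - 1 <= `|m|%N%:R.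
  by rewrite natr_absz ger0_norm// ceil_ge.
have [t Gt] := min_le_average C0 eps0 (sum_le `|m|%N) le_m.
(* The left alternative would bound the default [+oo]; the iterate found above supplies the right
   one. *)
by apply/bigmin_leP; right; exists t => //; rewrite gapE lee_fin.
Qed.
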